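(* For all $n\ge0$, $$\partial_{s}X_{n,n} = \xi s^{a}e^{-s}\left[ -\frac{S_{n}}{S_{n+1}}P_{n+1}(s)Q^{(1)}_{n}(-s) + \frac{S_{n-1}}{S_{n}}P_{n}(s)Q^{(1)}_{n-1}(-s) \right],$$ $$\partial_{t}X_{n,n} = \psi t^{b}e^{-t}\left[ -\frac{S_{n}}{S_{n+1}}P^{(1)}_{n+1}(-t)Q_{n}(t) + \frac{S_{n-1}}{S_{n}}P^{(1)}_{n}(-t)Q_{n-1}(t) \right],$$ $$\partial_{s}Y_{n,n} = \xi s^{a}e^{-s}\left[ -\frac{S_{n}}{S_{n+1}}P_{n}(s)Q^{(1)}_{n+1}(-s) + \frac{S_{n-1}}{S_{n}}P_{n-1}(s)Q^{(1)}_{n}(-s) \right],$$ $$\partial_{t}Y_{n,n} = \psi t^{b}e^{-t}\left[ -\frac{S_{n}}{S_{n+1}}P^{(1)}_{n}(-t)Q_{n+1}(t) + \frac{S_{n-1}}{S_{n}}P^{(1)}_{n-1}(-t)Q_{n}(t) \right].$$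
   Context: Fix $a,b,\xi,\psi\in\mathbb C$ with $\Re a,\Re b>-1$. For $s,t>0$ put $w_1(x)=(1-\xi\chi_{x>s})x^ae^{-x}$, $w_2(y)=(1-\psi\chi_{y>t})y^be^{-y}$ on $(0,\infty)$, $\langle f,g\rangle=\int_0^\infty\int_0^\infty\frac{w_1(x)w_2(y)}{x+y}f(x)g(y)\,dx\,dy$, $M_{j,k}=\langle x^j,y^k\rangle$, $Z_0=1$, $Z_n=\det(M_{j,k})_{0\le j,k\le n-1}$. $P_n,Q_n$ are polynomials of degree $n$ with the same leading coefficient $S_n$ ($S_n^2=Z_n/Z_{n+1}$, branch chosen differentiably in $(s,t)$) and $\langle P_m,Q_n\rangle=\delta_{m,n}$. $X_{n,n}=\langle xP_n,Q_n\rangle$, $Y_{n,n}=\langle P_n,yQ_n\rangle$, $P^{(1)}_n(z)=\int_0^\infty\frac{w_1(x)}{z-x}P_n(x)\,dx$, $Q^{(1)}_n(z)=\int_0^\infty\frac{w_2(y)}{z-y}Q_n(y)\,dy$. Objects with index $-1$ are $0$. $(s,t)$ ranges over an open set on which the standing generic conditions hold: all $M_{j,k}$ finite (absolutely convergent), $Z_n\ne0$, and $\int w_1P_n\ne0$, $\int w_2Q_n\neq0$ for all $n\ge0$. *)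

(* Defs.v *)
From mathcomp Require Import all_boot all_order all_algebra.
From mathcomp Require Import all_classical all_reals all_analysis.
From mathcomp Require Import complex.
Set Implicit Arguments.
Unset Strict Implicit.
Unset Printing Implicit Defensive.
Import Order.TTheory GRing.Theory Num.Theory.
Import numFieldNormedType.Exports.
Local Open Scope classical_set_scope.
Local Open Scope ring_scope.
Local Open Scope complex_scope.

Section ComplexAnalysis.
Context {R : realType}.

(* The analysis library integrates and differentiates real-valued functions;
   for R[i]-valued ones both are taken componentwise. *)

Definition cintegrable d (T : measurableType d)
    (mu : {measure set T -> \bar R}) (D : set T) (f : T -> R[i]) : Prop :=
  mu.-integrable D (EFin \o (fun x => complex.Re (f x))) /\
  mu.-integrable D (EFin \o (fun x => complex.Im (f x))).

Definition cintegral d (T : measurableType d)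
    (mu : {measure set T -> \bar R}) (D : set T) (f : T -> R[i]) : R[i] :=
  (\int[mu]_(x in D) complex.Re (f x)) +i* (\int[mu]_(x in D) complex.Im (f x)).

Definition is_cderive (f : R -> R[i]) (x : R) (l : R[i]) : Prop :=
  is_derive x 1 (fun y => complex.Re (f y)) (complex.Re l) /\
  is_derive x 1 (fun y => complex.Im (f y)) (complex.Im l).

Definition cdifferentiable2 (f : R -> R -> R[i]) (p : R * R) : Prop :=
  differentiable (fun q : R * R => complex.Re (f q.1 q.2)) p /\
  differentiable (fun q : R * R => complex.Im (f q.1 q.2)) p.

(* x^c = exp (c ln x), meant for x > 0 *)
Definition cpow (x : R) (c : R[i]) : R[i] :=
  (expR (complex.Re c * ln x))%:C *
  (cos (complex.Im c * ln x) +i* sin (complex.Im c * ln x)).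

End ComplexAnalysis.

(* Value at n - 1 of a family indexed by n >= 0, with the convention that the
   member of index -1 is 0. *)
Definition at_pred (V : nmodType) (f : nat -> V) (n : nat) : V :=
  if n is m.+1 then f m else 0.

Section Bimoments.
Context {R : realType}.
Implicit Types (a b xi psi z : R[i]) (s t x y : R) (f g : {poly R[i]}).

Definition halfline : set (measurableTypeR R) := `]0, +oo[.

Definition quadrant : set (measurableTypeR R * measurableTypeR R) :=
  halfline `*` halfline.

(* w_1 is [weight xi a s] and w_2 is [weight psi b t] *)
Definition weight xi a s x : R[i] :=
  (1 - xi * (s < x)%R%:R) * cpow x a * (expR (- x))%:C.

Definition pair_integrand a b xi psi s t f g (p : R * R) : R[i] :=
  weight xi a s p.1 * weight psi b t p.2 / (p.1 + p.2)%:C *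
  f.[p.1%:C] * g.[p.2%:C].

Local Notation lebesgue2 := (@lebesgue_measure R \x @lebesgue_measure R)%E.

Definition pairing a b xi psi s t f g : R[i] :=
  cintegral lebesgue2 quadrant (pair_integrand a b xi psi s t f g).

Definition bimoment a b xi psi s t (j k : nat) : R[i] :=
  pairing a b xi psi s t 'X^j 'X^k.

Definition bimoment_convergent a b xi psi s t (j k : nat) : Prop :=
  cintegrable lebesgue2 quadrant (pair_integrand a b xi psi s t 'X^j 'X^k).

Definition Zdet a b xi psi s t (n : nat) : R[i] :=
  \det (\matrix_(j < n, k < n) bimoment a b xi psi s t j k).

Definition weight_integral (w : R -> R[i]) f : R[i] :=
  cintegral (@lebesgue_measure R) halfline (fun x => w x * f.[x%:C]).

Definition cauchy_transform (w : R -> R[i]) f z : R[i] :=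
  cintegral (@lebesgue_measure R) halfline
    (fun x => w x / (z - x%:C) * f.[x%:C]).

End Bimoments.

(* Main.v *)
Require Import Defs.
From mathcomp Require Import all_boot all_order all_algebra.
From mathcomp Require Import all_classical all_reals all_analysis.
From mathcomp Require Import measurable_realfun.
From mathcomp Require Import complex.
From mathcomp Require Import ring lra.
Import Order.TTheory GRing.Theory Num.Theory.
Import numFieldNormedType.Exports.
Set Implicit Arguments.
Unset Strict Implicit.
Unset Printing Implicit Defensive.
Local Open Scope classical_set_scope.
Local Open Scope ring_scope.
Local Open Scope complex_scope.

(* Write P_n = S_n pi_n with pi_n monic, and let c_n be the coefficient of
   degree n - 1 in pi_n.  Expanding x P_n in the P_k gives
   X_{n,n} = c_n - c_{n+1}, so only c_n has to be differentiated.  Comparing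
   two values u and u0 of the parameter, biorthogonality at u0 yields the exact
   formula
     c_n(u) - c_n(u0) = - S_{n-1} (<pi_n(u), Q_{n-1}>_u - <pi_n(u), Q_{n-1}>_{u0})
   with S_{n-1} and Q_{n-1} taken at u0; as pi_n(u) -> pi_n(u0) by Cramer's
   rule, the derivative of c_n is - S_{n-1} <pi_n, Q_{n-1}>' where <,>' is the
   form of the derivatives of the bimoments.
   Moving the cut s changes the integrand of a bimoment only on the strip
   between the two cuts, so by Fubini and the fundamental theorem of calculus
   d/ds M_{j,k} = xi s^a e^{-s} s^j \int w_2(y) y^k / (s + y) dy.  The rows
   for t and for Y follow by exchanging the roles of the two variables. *)

(** * Componentwise limits of complex-valued functions *)

Section ComplexLimits.
Context {R : realType}.
Implicit Types (z l : R[i]) (x : R).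

Lemma Re_mulc z l : complex.Re (z * l)
  = complex.Re z * complex.Re l - complex.Im z * complex.Im l.
Proof. by case: z; case: l. Qed.

Lemma Im_mulc z l : complex.Im (z * l)
  = complex.Re z * complex.Im l + complex.Im z * complex.Re l.
Proof. by case: z => ? ?; case: l => ? ? /=; rewrite (mulrC _ (_ : R)). Qed.

Lemma Re_addc z l : complex.Re (z + l) = complex.Re z + complex.Re l.
Proof. by case: z; case: l. Qed.

Lemma Im_addc z l : complex.Im (z + l) = complex.Im z + complex.Im l.
Proof. by case: z; case: l. Qed.

Lemma Re_subc z l : complex.Re (z - l) = complex.Re z - complex.Re l.
Proof. by case: z; case: l. Qed.

Lemma Im_subc z l : complex.Im (z - l) = complex.Im z - complex.Im l.
Proof. by case: z; case: l. Qed.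

Definition ccvg {T : Type} (F : set_system T) (f : T -> R[i]) l : Prop :=
  (fun h => complex.Re (f h)) @ F --> complex.Re l /\
  (fun h => complex.Im (f h)) @ F --> complex.Im l.

Section Filter.
Context {T : Type} {F : set_system T} {FF : Filter F}.
Implicit Types f g : T -> R[i].

Lemma ccvg_cst z : ccvg F (fun=> z) z.
Proof. by split; apply: cvg_cst. Qed.

Lemma ccvgD f g z l : ccvg F f z -> ccvg F g l ->
  ccvg F (fun h => f h + g h) (z + l).
Proof.
move=> [f1 f2] [g1 g2]; split; rewrite ?Re_addc ?Im_addc.
  by under eq_fun do rewrite Re_addc; apply: cvgD.
by under eq_fun do rewrite Im_addc; apply: cvgD.
Qed.

Lemma ccvgM f g z l : ccvg F f z -> ccvg F g l ->
  ccvg F (fun h => f h * g h) (z * l).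
Proof.
move=> [f1 f2] [g1 g2]; split; rewrite ?Re_mulc ?Im_mulc.
  by under eq_fun do rewrite Re_mulc; apply: cvgB; apply: cvgM.
by under eq_fun do rewrite Im_mulc; apply: cvgD; apply: cvgM.
Qed.

Lemma ccvgN f z : ccvg F f z -> ccvg F (fun h => - f h) (- z).
Proof.
move=> cf; rewrite -mulN1r; under eq_fun do rewrite -mulN1r.
exact: ccvgM (ccvg_cst _) cf.
Qed.

(** Both components of an inverse are quotients by the squared modulus, whose limit is nonzero
    because [z] is. *)
Lemma ccvgV f z : z != 0 -> ccvg F f z -> ccvg F (fun h => (f h)^-1) z^-1.
Proof.
have ReV (c : R[i]) : complex.Re c^-1
    = complex.Re c / (complex.Re c ^+ 2 + complex.Im c ^+ 2) by case: c.
have ImV (c : R[i]) : complex.Im c^-1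
    = - complex.Im c / (complex.Re c ^+ 2 + complex.Im c ^+ 2).
  by case: c => ? ? /=; rewrite mulNr.
move=> z0 [f1 f2].
have n0 : complex.Re z ^+ 2 + complex.Im z ^+ 2 != 0.
  apply: contra_neq z0 => /eqP.
  rewrite paddr_eq0 ?sqr_ge0// !sqrf_eq0 => /andP[/eqP r0 /eqP i0].
  by case: z r0 i0 {f1 f2} => ? ? /= -> ->.
have cN : (fun h => complex.Re (f h) ^+ 2 + complex.Im (f h) ^+ 2) @ F -->
    complex.Re z ^+ 2 + complex.Im z ^+ 2.
  by apply: cvgD; rewrite expr2; under eq_fun do rewrite expr2; apply: cvgM.
split; rewrite ?ReV ?ImV.
  by under eq_fun do rewrite ReV; apply: cvgM => //; apply: cvgV.
under eq_fun do rewrite ImV; apply: cvgM; [exact: cvgN|exact: cvgV].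
Qed.

Lemma ccvg_sum (I : Type) (r : seq I) (p : pred I) (f : I -> T -> R[i])
    (l : I -> R[i]) : (forall i, p i -> ccvg F (f i) (l i)) ->
  ccvg F (fun h => \sum_(i <- r | p i) f i h) (\sum_(i <- r | p i) l i).
Proof.
move=> fl; elim: r => [|i r IH].
  by rewrite big_nil; under eq_fun do rewrite big_nil; exact: ccvg_cst.
rewrite big_cons; under eq_fun do rewrite big_cons.
by case: ifP => // pi; apply: ccvgD => //; exact: fl.
Qed.

Lemma ccvg_prod (I : Type) (r : seq I) (p : pred I) (f : I -> T -> R[i])
    (l : I -> R[i]) : (forall i, p i -> ccvg F (f i) (l i)) ->
  ccvg F (fun h => \prod_(i <- r | p i) f i h) (\prod_(i <- r | p i) l i).
Proof.
move=> fl; elim: r => [|i r IH].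
  by rewrite big_nil; under eq_fun do rewrite big_nil; exact: ccvg_cst.
rewrite big_cons; under eq_fun do rewrite big_cons.
by case: ifP => // pi; apply: ccvgM => //; exact: fl.
Qed.

Lemma near_eq_ccvg f g l : (\forall h \near F, f h = g h) ->
  ccvg F f l -> ccvg F g l.
Proof.
move=> fg [f1 f2]; split.
  apply: cvg_trans f1; apply: near_eq_cvg.
  by apply: filterS fg => h ->.
apply: cvg_trans f2; apply: near_eq_cvg.
by apply: filterS fg => h ->.
Unshelve. all: by end_near. Qed.

(** The Leibniz formula makes a determinant a polynomial in its entries. *)
Lemma ccvg_det n (A : T -> 'M[R[i]]_n) (B : 'M[R[i]]_n) :
  (forall i j, ccvg F (fun h => A h i j) (B i j)) ->
  ccvg F (fun h => \det (A h)) (\det B).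
Proof.
move=> AB; apply: ccvg_sum => s _; apply: ccvgM; first exact: ccvg_cst.
by apply: ccvg_prod.
Qed.

Lemma ccvg_adj n (A : T -> 'M[R[i]]_n) (B : 'M[R[i]]_n) :
  (forall i j, ccvg F (fun h => A h i j) (B i j)) ->
  forall i j, ccvg F (fun h => (\adj (A h)) i j) ((\adj B) i j).
Proof.
move=> AB i j; rewrite mxE; under eq_fun do rewrite mxE.
apply: ccvgM; first exact: ccvg_cst.
apply: ccvg_det => k l; rewrite !mxE; under eq_fun do rewrite !mxE.
exact: AB.
Qed.

End Filter.

Lemma is_derive_cvgP (f : R -> R) x (d : R) : is_derive x 1 f d <->
  (fun h => h^-1 * (f (x + h) - f x)) @ 0^' --> d.
Proof.
have E : (fun h => h^-1 * (f (x + h) - f x)) =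
         (fun h => h^-1 *: ((f \o shift x) (h *: (1 : R)) - f x)).
  by apply/funext => h /=; rewrite [h *: _]mulr1 (addrC x).
rewrite E; split.
  by move=> [df <-]; exact: df.
move=> c; split; first by apply/cvg_ex; exists d.
exact/cvg_lim.
Qed.

(** Turns componentwise differentiation into a limit of complex difference quotients, to which the
    limit algebra above applies. *)
Lemma is_cderive_ccvgP (f : R -> R[i]) x l : is_cderive f x l <->
  ccvg ((0 : R)^') (fun h : R => h^-1%:C * (f (x + h) - f x)) l.
Proof.
rewrite /is_cderive /ccvg !is_derive_cvgP.
suff [e1 e2] : (fun h : R => complex.Re (h^-1%:C * (f (x + h) - f x)))
     = (fun h => h^-1 * (complex.Re (f (x + h)) - complex.Re (f x)))
  /\ (fun h : R => complex.Im (h^-1%:C * (f (x + h) - f x)))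
     = (fun h => h^-1 * (complex.Im (f (x + h)) - complex.Im (f x))) by rewrite e1 e2.
split; apply/funext => h.
  by rewrite Re_mulc mul0r subr0 Re_subc.
by rewrite Im_mulc mul0r addr0 Im_subc.
Qed.

End ComplexLimits.

(** * Biorthogonal polynomials of a matrix of moments *)

Section MomentForms.
Context {F : fieldType}.
Implicit Types (f g : {poly F}) (mu : nat -> F) (m : nat -> nat -> F).

(** The linear functional with moments [mu], defined on coefficients so that the theory below is
    algebraic and free of integrals. *)
Definition lform mu f : F := \sum_(j < size f) f`_j * mu j.

Lemma lform_widen mu f N : (size f <= N)%N ->
  lform mu f = \sum_(j < N) f`_j * mu j.
Proof.
move=> fN; rewrite /lform (big_ord_widen N (fun j => f`_j * mu j))// big_mkcond.
apply: eq_bigr => j _; case: ltnP => // fj.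
by rewrite nth_default// mul0r.
Qed.

Lemma lformD mu f g : lform mu (f + g) = lform mu f + lform mu g.
Proof.
rewrite (lform_widen _ (size_polyD f g)) (lform_widen _ (leq_maxl (size f) (size g))).
rewrite (lform_widen _ (leq_maxr (size f) (size g))) -big_split.
by apply: eq_bigr => j _; rewrite coefD mulrDl.
Qed.

Lemma lformZ mu c f : lform mu (c *: f) = c * lform mu f.
Proof.
rewrite (lform_widen _ (size_scale_leq c f)) /lform mulr_sumr.
by apply: eq_bigr => j _; rewrite coefZ mulrA.
Qed.

Lemma lform0 mu : lform mu 0 = 0.
Proof. by rewrite /lform size_poly0 big_ord0. Qed.

Lemma lformXn mu n : lform mu 'X^n = mu n.
Proof.
rewrite /lform size_polyXn big_ord_recr /= coefXn eqxx mul1r big1 ?add0r// => j _.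
by rewrite coefXn ltn_eqF ?mul0r.
Qed.

Lemma lformZm mu c f : lform (fun j => c * mu j) f = c * lform mu f.
Proof. by rewrite /lform mulr_sumr; apply: eq_bigr => j _; rewrite mulrCA. Qed.

Definition bform m f g : F := lform (fun j => lform (m j) g) f.

Lemma bformC m f g : bform m f g = bform (fun k j => m j k) g f.
Proof.
rewrite /bform /lform; under eq_bigr do rewrite mulr_sumr.
rewrite exchange_big; apply: eq_bigr => k _; rewrite mulr_sumr.
by apply: eq_bigr => j _; rewrite mulrCA.
Qed.

Lemma bform_widen m f g N N' : (size f <= N)%N -> (size g <= N')%N ->
  bform m f g = \sum_(j < N) \sum_(k < N') f`_j * g`_k * m j k.
Proof.
move=> fN gN; rewrite /bform (lform_widen _ fN); apply: eq_bigr => j _.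
rewrite (lform_widen _ gN) mulr_sumr; apply: eq_bigr => k _.
by rewrite mulrA.
Qed.

Definition biorthonormal m (S : nat -> F) (P Q : nat -> {poly F}) : Prop :=
  [/\ forall n, \det (\matrix_(j < n, k < n) m j k) != 0,
      forall n, size (P n) = n.+1 /\ lead_coef (P n) = S n,
      forall n, size (Q n) = n.+1 /\ lead_coef (Q n) = S n &
      forall i j, bform m (P i) (Q j) = (i == j)%:R].

(** Transposing the moments exchanges [P] and [Q]; this is how results on X become results on Y. *)
Lemma biorthonormalC m S P Q : biorthonormal m S P Q ->
  biorthonormal (fun k j => m j k) S Q P.
Proof.
move=> [det_m sP sQ PQ]; split=> //.
- move=> n; rewrite -det_tr; move: (det_m n); congr (\det _ != 0).
  by apply/matrixP => j k; rewrite !mxE.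
- by move=> i j; rewrite -bformC PQ eq_sym.
Qed.

Section Biorthonormal.
Context {m : nat -> nat -> F} {S : nat -> F} {P Q : nat -> {poly F}}.
Hypothesis bo : biorthonormal m S P Q.

Lemma bo_coef n : (P n)`_n = S n.
Proof. by case: bo => _ /(_ n)[sz <-] _ _; rewrite lead_coefE sz. Qed.

Lemma bo_neq0 n : S n != 0.
Proof.
case: bo => _ /(_ n)[sz <-] _ _.
by rewrite lead_coef_eq0 -size_poly_eq0 sz.
Qed.

Let size_subtract n f : (size f <= n.+1)%N ->
  (size (f - (f`_n / S n) *: P n)%R <= n)%N.
Proof.
case: (bo) => _ /(_ n)[sz _] _ _ => sf; apply/leq_sizeP => j.
rewrite leq_eqVlt => /predU1P[<-|nj]; rewrite coefB coefZ.
  by rewrite bo_coef divfK ?bo_neq0// subrr.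
have f0 : f`_j = 0 by rewrite nth_default// (leq_trans sf).
have P0 : (P n)`_j = 0 by rewrite nth_default// sz.
by rewrite f0 P0 mulr0 subrr.
Qed.

(** Expand [f] in P_0, ..., P_n by stripping top terms one by one: each P_k with k < n is orthogonal
    to Q_n, and P_n enters with the ratio of the coefficients of degree n. *)
Lemma bform_top n f : (size f <= n.+1)%N -> bform m f (Q n) = f`_n / S n.
Proof.
case: (bo) => _ _ _ PQ.
have expand k (h : {poly F}) : (size h <= k.+1)%N -> bform m h (Q n)
    = bform m (h - (h`_k / S k) *: P k) (Q n) + (h`_k / S k) * (k == n)%:R.
  by move=> sh; rewrite -PQ /bform -lformZ -lformD subrK.
have low k (h : {poly F}) : (k <= n)%N -> (size h <= k)%N -> bform m h (Q n) = 0.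
  elim: k h => [|k IH] h kn sh.
    by move: sh; rewrite leqn0 size_poly_eq0 => /eqP ->; exact: lform0.
  rewrite (expand _ _ sh) (ltn_eqF kn) mulr0 addr0.
  by apply: IH; [exact: ltnW|exact: size_subtract].
move=> sf; rewrite (expand _ _ sf) eqxx mulr1 (low n) ?add0r//.
exact: size_subtract.
Qed.

Lemma bform_low n f : (size f <= n)%N -> bform m f (Q n) = 0.
Proof.
by move=> fn; rewrite bform_top ?(leq_trans fn)// nth_default// mul0r.
Qed.

(** This is X_{n,n} = c_n - c_{n+1}. Multiplication by ['X] shifts coefficients, so the coefficient
    of degree n of ['X * P n] is that of degree n - 1 of [P n], and 0 when n = 0. *)
Lemma bform_mulX n : bform m ('X * P n) (Q n)
  = ('X * P n)`_n / S n - ('X * P n.+1)`_n.+1 / S n.+1.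
Proof.
case: (bo) => _ sz _ PQ.
have sf : (size ('X * P n)%R <= n.+2)%N.
  by rewrite (leq_trans (size_polyMleq _ _))// size_polyX (sz n).1.
(* The multiple of [P n.+1] removed here is orthogonal to [Q n]; it cancels the term of degree n +
   1, after which [bform_top] applies. *)
have -> : bform m ('X * P n) (Q n)
    = bform m ('X * P n - (('X * P n)`_n.+1 / S n.+1) *: P n.+1) (Q n).
  rewrite -[in LHS](subrK ((('X * P n)`_n.+1 / S n.+1) *: P n.+1) ('X * P n)).
  by rewrite /bform lformD lformZ -!/(bform _ _ _) PQ gtn_eqF// mulr0 addr0.
rewrite bform_top; last exact: size_subtract.
rewrite coefB coefZ !coefXM /= bo_coef.
by field; rewrite !bo_neq0.
Qed.

End Biorthonormal.

Lemma bform_lowl m S P Q n g : biorthonormal m S P Q -> (size g <= n)%N ->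
  bform m (P n) g = 0.
Proof. by move=> /biorthonormalC bo gn; rewrite bformC (bform_low bo). Qed.

(** Cramer's rule: orthogonality of P_n to 1, y, ..., y^(n-1) is a linear system for the lower
    coefficients of the monic multiple of P_n. It exhibits these coefficients as rational functions
    of the moments. *)
Lemma monic_coefE m S P Q n (j : 'I_n) : biorthonormal m S P Q ->
  (P n)`_j / S n = - (\sum_(k < n) m n k *
      (\adj (\matrix_(i < n, k < n) m i k)) k j)
    / \det (\matrix_(j < n, k < n) m j k).
Proof.
move=> bo; case: (bo) => /(_ n) det0 /(_ n)[sz _] _ _.
set M := \matrix_(_, _) _ in det0 *.
have S0 := bo_neq0 bo n.
pose r : 'rV[F]_n := \row_j ((P n)`_j / S n).
(* The top coefficient of the monic polynomial is 1, so row n of the moments moves to the right-hand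
   side with a minus sign. *)
have rM : r *m M = - \row_k m n k.
  apply/rowP => k; rewrite !mxE.
  have : bform m (P n) 'X^k = 0 by apply: (bform_lowl bo); rewrite size_polyXn.
  rewrite /bform /lform sz big_ord_recr /= (bo_coef bo) -!/(lform _ _) lformXn.
  move=> /(canRL (addrK _)); rewrite sub0r => E.
  rewrite -(mulKf S0 (- m n k)) mulrN -E mulr_sumr; apply: eq_bigr => i _.
  by rewrite !mxE -/(lform _ _) lformXn; ring.
have : r *m M *m \adj M = r *m (\det M)%:M by rewrite -mulmxA mul_mx_adj.
rewrite rM mul_mx_scalar => /rowP/(_ j); rewrite !mxE => E.
apply: (mulIf det0); rewrite divfK// mulrC -E -sumrN.
by apply: eq_bigr => k _; rewrite !mxE mulNr.
Qed.

End MomentForms.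

(** * Derivative of X_{n,n} along a one-parameter family of moment matrices *)

Section Derivative.
Context {R : realType}.
Implicit Types (u h : R).

Lemma is_cderiveB (f g : R -> R[i]) u k l : is_cderive f u k ->
  is_cderive g u l -> is_cderive (fun x => f x - g x) u (k - l).
Proof.
move=> [f1 f2] [g1 g2]; split; rewrite ?Re_subc ?Im_subc.
  by under eq_fun do rewrite Re_subc; apply: is_deriveB.
by under eq_fun do rewrite Im_subc; apply: is_deriveB.
Qed.

Lemma near_eq_is_cderive (f g : R -> R[i]) u l :
  (\forall x \near u, f x = g x) -> is_cderive f u l -> is_cderive g u l.
Proof.
move=> fg /is_cderive_ccvgP cf; apply/is_cderive_ccvgP.
apply: near_eq_ccvg cf; rewrite (nbhs_singleton fg).
have : \forall h \near (0 : R), f (u + h) = g (u + h).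
  have : (fun h => u + h) @ (0 : R) --> u.
    by rewrite -[X in _ --> X]addr0; apply: cvgD; [exact: cvg_cst|exact: cvg_id].
  by move/(_ _ fg).
by move/(@nbhs_dnbhs _ _ _); apply: filterS => h ->.
Qed.

Lemma is_cderive_continuous (f : R -> R[i]) u l : is_cderive f u l ->
  ccvg ((0 : R)^') (fun h => f (u + h)) (f u).
Proof.
move=> /is_cderive_ccvgP cf.
have id0 : ccvg ((0 : R)^') (fun h => h%:C) 0.
  split; last exact: cvg_cst.
  by apply: cvg_within_filter; exact: cvg_id.
(* f(u + h) is rebuilt as f(u) plus h times the difference quotient; h is nonzero in the punctured
   neighbourhood. *)
have cf' : ccvg ((0 : R)^') (fun h => f u + h%:C * (h^-1%:C * (f (u + h) - f u)))
    (f u + 0 * l).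
  by apply: ccvgD; [exact: ccvg_cst|exact: ccvgM].
move: cf'; rewrite mul0r addr0 => cf'; apply: near_eq_ccvg cf'.
near=> h.
have h0 : h != 0 by near: h; exact: nbhs_dnbhs_neq.
by rewrite mulrA -rmorphM/= divff// mul1r addrC subrK.
Unshelve. all: by end_near. Qed.

Section Family.
Variables (m : R -> nat -> nat -> R[i]) (D : nat -> nat -> R[i]).
Variables (S : nat -> R -> R[i]) (P Q : nat -> R -> {poly R[i]}) (u0 : R).
Hypothesis bo : \forall u \near u0,
  biorthonormal (m u) (S ^~ u) (P ^~ u) (Q ^~ u).
Hypothesis mD : forall j k, is_cderive (fun u => m u j k) u0 (D j k).

Let bo0 := nbhs_singleton bo.

Let boh : \forall h \near (0 : R)^',
  biorthonormal (m (u0 + h)) (S ^~ (u0 + h)) (P ^~ (u0 + h)) (Q ^~ (u0 + h)).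
Proof.
apply: nbhs_dnbhs.
have : (fun h => u0 + h) @ (0 : R) --> u0.
  by rewrite -[X in _ --> X]addr0; apply: cvgD; [exact: cvg_cst|exact: cvg_id].
by move/(_ _ bo).
Qed.

(** The top coefficient is constantly 1; the lower ones are given by Cramer's rule, with a
    determinant that does not vanish at [u0]. *)
Let monic_coef_continuous n (j : 'I_n.+1) :
  ccvg ((0 : R)^') (fun h => (P n (u0 + h))`_j / S n (u0 + h))
    ((P n u0)`_j / S n u0).
Proof.
have [jn|jn] := ltnP j n; last first.
  have -> : nat_of_ord j = n by apply/eqP; rewrite eqn_leq jn -ltnS ltn_ord.
  rewrite (bo_coef bo0) divff ?(bo_neq0 bo0 n)//.
  apply: near_eq_ccvg (ccvg_cst 1).
  apply: filterS boh => h bo_h.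
  by rewrite (bo_coef bo_h) divff ?(bo_neq0 bo_h n).
rewrite (@monic_coefE _ _ _ _ _ n (Ordinal jn) bo0).
apply: (@near_eq_ccvg _ _ _ _ (fun h => - (\sum_(k < n) m (u0 + h) n k *
      (\adj (\matrix_(i < n, k < n) m (u0 + h) i k)) k (Ordinal jn))
    / \det (\matrix_(j < n, k < n) m (u0 + h) j k))).
  by apply: filterS boh => h bo_h; rewrite -(monic_coefE _ bo_h).
have mc i k : ccvg ((0 : R)^')
    (fun h => (\matrix_(i < n, k < n) m (u0 + h) i k) i k)
    ((\matrix_(i < n, k < n) m u0 i k) i k).
  rewrite mxE; under eq_fun do rewrite mxE; exact: (is_cderive_continuous (mD i k)).
apply: ccvgM.
  apply: ccvgN; apply: ccvg_sum => k _; apply: ccvgM.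
    exact: (is_cderive_continuous (mD n k)).
  exact: ccvg_adj.
apply: ccvgV; first by case: bo0.
exact: ccvg_det.
Qed.

(* If pi is the monic multiple of P n at u, and pi0, Q0 the data at u0, then
   pi - pi0 has degree < n, so its coefficient of degree n - 1 is
   <pi - pi0, Q0>_u0 S0 = <pi, Q0>_u0 S0 where Q0 has degree n - 1. As
   <pi, Q0>_u = 0, only the increment of the form and the limit of pi
   matter. *)
Let subleading_derive n :
  is_cderive (fun u => ('X * P n u)`_n / S n u) u0
    (- (at_pred (S ^~ u0) n / S n u0
        * bform D (P n u0) (at_pred (Q ^~ u0) n))).
Proof.
(* For n = 0 the coefficient vanishes for every parameter, in agreement with the convention on index
   -1. *)
case: n => [|n] /=.
  rewrite mul0r mul0r oppr0; apply/is_cderive_ccvgP.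
  apply: near_eq_ccvg (ccvg_cst _); apply: nearW => h.
  by rewrite !coefXM /= !mul0r subrr mulr0.
apply/is_cderive_ccvgP.
have [_ szP szQ PQ] := bo0.
have -> : - (S n u0 / S n.+1 u0 * bform D (P n.+1 u0) (Q n u0))
  = - S n u0 * \sum_(j < n.+2) ((P n.+1 u0)`_j / S n.+1 u0)
      * \sum_(k < n.+1) (Q n u0)`_k * D j k.
  rewrite (@bform_widen _ _ _ _ n.+2 n.+1) ?(szP n.+1).1 ?(szQ n).1//.
  rewrite mulNr -mulrA mulr_sumr; congr (- (_ * _)).
  apply: eq_bigr => j _; rewrite !mulr_sumr; apply: eq_bigr => k _; ring.
(* Only [P] sits at the moving parameter: [Q] is frozen at [u0] and the difference quotient falls on
   the moments alone. *)
apply: (@near_eq_ccvg _ _ _ _ (fun h => - S n u0 * \sum_(j < n.+2)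
    ((P n.+1 (u0 + h))`_j / S n.+1 (u0 + h))
      * \sum_(k < n.+1) (Q n u0)`_k * (h^-1%:C * (m (u0 + h) j k - m u0 j k)))).
  apply: filterS boh => h bo_h; have [_ szP' _ _] := bo_h.
  have S0 := bo_neq0 bo0; have Sh := bo_neq0 bo_h.
  set w := u0 + h; set pi := (S n.+1 w)^-1 *: P n.+1 w.
  pose pi0 := (S n.+1 u0)^-1 *: P n.+1 u0.
  have szpi : (size pi <= n.+2)%N.
    by rewrite (leq_trans (size_scale_leq _ _))// (szP' n.+1).1.
  have top : (size (pi - pi0)%R <= n.+1)%N.
    apply/leq_sizeP => j; rewrite leq_eqVlt => /predU1P[<-|nj]; rewrite coefB !coefZ.
      by rewrite (bo_coef bo_h) (bo_coef bo0) !mulVf ?subrr ?S0 ?Sh.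
    by rewrite !nth_default ?mulr0 ?subrr ?(szP' n.+1).1 ?(szP n.+1).1.
  have /(congr1 ( *%R^~ (S n u0))) := bform_top bo0 top.
  rewrite divfK ?S0// coefB !coefZ => E.
  have piQ : bform (m w) pi (Q n u0) = 0.
    by rewrite /bform lformZ -/(bform _ _ _) (bform_lowl bo_h) ?mulr0// (szQ n).1.
  have pi0Q : bform (m u0) pi0 (Q n u0) = 0.
    by rewrite /bform lformZ -/(bform _ _ _) PQ gtn_eqF ?mulr0.
  have {}E : (P n.+1 w)`_n / S n.+1 w - (P n.+1 u0)`_n / S n.+1 u0 =
      - S n u0 * (bform (m w) pi (Q n u0) - bform (m u0) pi (Q n u0)).
    rewrite mulrC [X in _ - X]mulrC -E piQ.
    rewrite -[in RHS](subrK pi0 pi) [in RHS]/bform lformD -!/(bform _ _ _) pi0Q.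
    ring.
  rewrite !coefXM /= E !(@bform_widen _ _ _ _ n.+2 n.+1) ?(szQ n).1//.
  rewrite mulrCA; congr (_ * _); rewrite -sumrB mulr_sumr; apply: eq_bigr => j _.
  rewrite -sumrB !mulr_sumr; apply: eq_bigr => k _; rewrite coefZ; ring.
apply: ccvgM; first exact: ccvg_cst.
apply: ccvg_sum => j _; apply: ccvgM; first exact: monic_coef_continuous.
apply: ccvg_sum => k _; apply: ccvgM; first exact: ccvg_cst.
exact: (proj1 (is_cderive_ccvgP _ _ _) (mD j k)).
Qed.

Lemma bform_mulX_derive n :
  is_cderive (fun u => bform (m u) ('X * P n u) (Q n u)) u0
    (S n u0 / S n.+1 u0 * bform D (P n.+1 u0) (Q n u0)
     - at_pred (S ^~ u0) n / S n u0
       * bform D (P n u0) (at_pred (Q ^~ u0) n)).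
Proof.
have -> : forall a b : R[i], a - b = - b - - a by move=> a b; ring.
apply: near_eq_is_cderive (is_cderiveB (subleading_derive n) (subleading_derive n.+1)).
by apply: filterS bo => u bo_u; rewrite (bform_mulX bo_u).
Qed.

End Family.

End Derivative.

(** * Derivative of a Stieltjes kernel integral cut at a point *)

Section Rectangles.
Context d1 d2 (T1 : measurableType d1) (T2 : measurableType d2) (R : realType).
Variable m1 : {sigma_finite_measure set T1 -> \bar R}.
Variable m2 : {sigma_finite_measure set T2 -> \bar R}.
Variables (A : set T1) (B : set T2).
Hypotheses (mA : measurable A) (mB : measurable B).

Let mAB : measurable (A `*` B). Proof. exact: measurableX. Qed.

Let restrict_xsection (f : T1 * T2 -> \bar R) x y :
  (f \_ (A `*` B)) (x, y) = if x \in A then ((fun y => f (x, y)) \_ B) y else 0%E.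
Proof.
rewrite !patchE in_setX /=; case: (x \in A) => //=.
Qed.

(** Fubini on the whole product for [f] extended by 0. Integrability of the sections makes the inner
    integrals finite, so passing through [fine] loses nothing. *)
Lemma Rintegral_prod (f : T1 * T2 -> R) :
  (m1 \x m2)%E.-integrable (A `*` B) (EFin \o f) ->
  (forall x, A x -> m2.-integrable B (fun y => (f (x, y))%:E)) ->
  \int[(m1 \x m2)%E]_(p in A `*` B) f p
    = \int[m1]_(x in A) \int[m2]_(y in B) f (x, y).
Proof.
move=> /(integrable_mkcond _ mAB) fi fx; rewrite /Rintegral; congr fine.
rewrite integral_mkcond -integral12_prod_meas1// [RHS]integral_mkcond.
apply: eq_integral => x _; rewrite /fubini_F patchE.
under eq_integral do rewrite restrict_xsection.
case: ifPn => [/set_mem Ax|_]; last exact: integral0.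
rewrite -integral_mkcond fineK//.
exact: (integrable_fin_num mB (fx x Ax)).
Qed.

(** Tonelli: the iterated integral of the absolute value factors into two finite integrals. *)
Lemma integrable_prod (a : T1 -> R) (b : T2 -> R) :
  m1.-integrable A (EFin \o a) -> m2.-integrable B (EFin \o b) ->
  (m1 \x m2)%E.-integrable (A `*` B) (fun p => (a p.1 * b p.2)%:E).
Proof.
pose a' : T1 -> \bar R := (EFin \o a) \_ A.
pose b' : T2 -> \bar R := (EFin \o b) \_ B.
move=> /(integrable_mkcond _ mA) ia /(integrable_mkcond _ mB) ib.
have ma : measurable_fun setT a' by exact: measurable_int ia.
have mb : measurable_fun setT b' by exact: measurable_int ib.
apply/(integrable_mkcond _ mAB).
have -> : (fun p => (a p.1 * b p.2)%:E) \_ (A `*` B) =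
  (fun p => a' p.1 * b' p.2)%E.
  apply/funext => -[x y]; rewrite /a' /b' !patchE in_setX /=.
  by case: (x \in A); case: (y \in B); rewrite ?mul0e ?mule0.
apply/integrable12ltyP.
  apply: emeasurable_funM.
    exact: (measurableT_comp ma measurable_fst).
  exact: (measurableT_comp mb measurable_snd).
have E x : (\int[m2]_y `|a' x * b' y| = `|a' x| * \int[m2]_y `|b' y|)%E.
  rewrite -ge0_integralZl//; last exact: measurableT_comp.
  by apply: eq_integral => y _; rewrite abseM.
under eq_integral do rewrite E.
have /integrableP[_ fa] := ia; have /integrableP[_ fb] := ib.
rewrite ge0_integralZr//; last 2 first.
- exact: measurableT_comp.
- exact: integral_ge0.
by rewrite lte_mul_pinfty ?integral_ge0// ge0_fin_numE ?integral_ge0.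
Qed.

Lemma ae_integrable_xsection (f : T1 * T2 -> R) :
  (m1 \x m2)%E.-integrable (A `*` B) (EFin \o f) ->
  {ae m1, forall x, A x -> m2.-integrable B (fun y => (f (x, y))%:E)}.
Proof.
move=> /(integrable_mkcond _ mAB) /ae_integrable1; apply: filterS => x.
move=> fx /mem_set Ax; apply/(integrable_mkcond _ mB).
move: fx; congr (_.-integrable _ _); apply/funext => y.
by rewrite restrict_xsection Ax.
Qed.

(** Tonelli's criterion can be tested in either order, and Fubini in both orders identifies the
    values. *)
Lemma integrable_swap (f : T1 * T2 -> R) :
  (m1 \x m2)%E.-integrable (A `*` B) (EFin \o f) ->
  (m2 \x m1)%E.-integrable (B `*` A) (fun p => (f (p.2, p.1))%:E) /\
  \int[(m2 \x m1)%E]_(p in B `*` A) f (p.2, p.1)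
    = \int[(m1 \x m2)%E]_(p in A `*` B) f p.
Proof.
have E : (fun p => (f (p.2, p.1))%:E) \_ (B `*` A)
    = (fun p => ((EFin \o f) \_ (A `*` B)) (p.2, p.1)).
  apply/funext => -[x y]; rewrite /= !patchE !in_setX /= andbC.
  by case: ifP.
move=> /(integrable_mkcond _ mAB) fi.
pose f' : T1 * T2 -> \bar R := (EFin \o f) \_ (A `*` B).
have mf' : measurable_fun setT f' by exact: measurable_int fi.
have mf : measurable_fun setT (fun p : T2 * T1 => f' (p.2, p.1)).
  exact: (measurableT_comp mf' (@measurable_swap _ _ _ _)).
have si : (m2 \x m1)%E.-integrable setT (fun p : T2 * T1 => f' (p.2, p.1)).
  apply/(integrable21ltyP m2 m1 mf).
  exact: ((integrable12ltyP m1 m2 mf').1 fi).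
split; first by apply/(integrable_mkcond _ (measurableX mB mA)); rewrite E.
rewrite /Rintegral; congr fine.
rewrite integral_mkcond E [RHS]integral_mkcond -integral12_prod_meas1//.
by rewrite -integral21_prod_meas1.
Qed.

End Rectangles.

(** * Real Stieltjes integrals over the half-line and over strips *)

Section StieltjesKernel.
Context {R : realType}.
Local Notation mu := (@lebesgue_measure R).
Local Notation lebesgue2 := (mu \x mu)%E.

Let measurable_halfline : measurable (@halfline R).
Proof. exact: measurable_itv. Qed.

Lemma halflineE (x : R) : halfline x = (0 < x).
Proof. by rewrite /halfline /= in_itv/= andbT. Qed.

(** For f > 0 one has 1/f = exp (- ln f), a composition of measurable functions. *)
Lemma measurable_funV_pos d (T : measurableType d) (D : set T) (f : T -> R) :
  (forall x, D x -> 0 < f x) ->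
  measurable_fun D f -> measurable_fun D (fun x => (f x)^-1).
Proof.
move=> f0 mf; apply: (@eq_measurable_fun _ _ _ _ _ (fun x => expR (- ln (f x)))).
  by move=> x /set_mem Dx; rewrite expRN lnK// posrE f0.
apply: measurableT_comp => //; apply: measurableT_comp => //.
exact: measurableT_comp.
Qed.

(** The ratio (x0 + y) / (x + y) is bounded for y > 0, so integrability at a single point [x0]
    spreads to every positive [x]. *)
Lemma stieltjes_integrable (g : R -> R) (x0 x : R) : 0 < x0 -> 0 < x ->
  mu.-integrable halfline (fun y => (g y / (x0 + y))%:E) ->
  mu.-integrable halfline (fun y => (g y / (x + y))%:E).
Proof.
move=> x00 x_gt0 gi.
have quot_le (y : R) : 0 < y -> `|(x0 + y) / (x + y)| <= 1 + x0 / x.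
  move=> y0; rewrite ger0_norm; last by rewrite divr_ge0// addr_ge0// ltW.
  rewrite ler_pdivrMr ?addr_gt0// mulrDl mul1r mulrDr divfK ?gt_eqF//.
  have : 0 <= x0 / x * y by rewrite !mulr_ge0 ?invr_ge0 ?ltW.
  by move=> ?; lra.
have H : mu.-integrable halfline
    (fun y => (g y / (x0 + y) * ((x0 + y) / (x + y)))%:E).
  apply: (@integrableMl _ _ _ mu _ measurable_halfline _
    (fun y : measurableTypeR R => (x0 + y) / (x + y)) gi).
    apply: measurable_funM; first exact: measurable_funD.
    apply: measurable_funV_pos; last exact: measurable_funD.
    by move=> y; rewrite halflineE => y0; rewrite addr_gt0.
  exists (1 + x0 / x); split; first exact: num_real.
  move=> M xM y; rewrite /= halflineE => y0.
  by apply: le_trans (ltW xM); exact: quot_le.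
apply: eq_integrable H => // y /set_mem; rewrite halflineE => y0.
by rewrite mulrA divfK// gt_eqF// addr_gt0.
Qed.

Section RealKernel.
Variables f g : R -> R.
Hypothesis f_cont : forall x : R, 0 < x -> {for x, continuous f}.
Hypothesis g_int : forall x : R, 0 < x ->
  mu.-integrable halfline (fun y => (g y / (x + y))%:E).

Let G x := \int[mu]_(y in halfline) (g y / (x + y)).

(** Dominated convergence on ]x/2, 2x[, where the integrand is largest in absolute value at the left
    end x/2. *)
Lemma stieltjes_continuous (x : R) : 0 < x -> {for x, continuous G}.
Proof.
move=> x0.
have := @continuity_under_integral _ _ _ mu (fun x y => g y / (x + y))
  halfline measurable_halfline (x / 2) (x * 2).
move/(_ _ _ (fun y => `|g y / (x / 2 + y)|)); apply.
- move=> z; rewrite /= in_itv/= => /andP[z1 _].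
  by apply: g_int; rewrite (lt_trans _ z1)// divr_gt0.
- apply: aeW => y; rewrite halflineE => y0 z /set_mem.
  rewrite /= in_itv/= => /andP[z1 _].
  have z0 : 0 < z + y by rewrite addr_gt0// (lt_trans _ z1)// divr_gt0.
  apply: cvgM; first exact: cvg_cst.
  apply: cvgV; first by rewrite gt_eqF.
  by apply: cvgD; [exact: cvg_id|exact: cvg_cst].
- by apply: integrable_norm; apply: g_int; rewrite divr_gt0.
- move=> z; rewrite /= in_itv/= => /andP[z1 _].
  apply: aeW => y; rewrite halflineE => y0.
  have x20 : 0 < x / 2 by rewrite divr_gt0.
  rewrite !normrM ler_wpM2l// !normfV lef_pV2 ?posrE ?normr_gt0 ?gt_eqF ?addr_gt0//.
    by rewrite !gtr0_norm ?addr_gt0// ?lerD2r ?ltW//; apply: lt_trans z1.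
  exact: lt_trans z1.
- by rewrite inE /= in_itv/=; apply/andP; split; lra.
Qed.

(** Closed on the right because a cut acts on x > s strictly: moving it from c to s affects exactly
    c < x <= s. *)
Let strip c s : set (measurableTypeR R * measurableTypeR R) := `]c, s] `*` halfline.

Let f_int (c s : R) : 0 < c -> mu.-integrable `]c, s] (EFin \o f).
Proof.
move=> c0; apply: (@integrableS _ _ _ mu `[c, s]) => //.
  exact: subset_itv_oc_cc.
apply: continuous_compact_integrable; first exact: segment_compact.
apply: continuous_in_subspaceT => x /set_mem; rewrite /= in_itv/= => /andP[cx _].
by apply: f_cont; exact: lt_le_trans cx.
Qed.

(** For x > c the kernel 1/(x + y) is at most 1/(c + y), so the integrand is an integrable product
    times a ratio bounded by 1. *)
Lemma strip_integrable (c s : R) : 0 < c ->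
  lebesgue2.-integrable (strip c s) (fun p => (f p.1 * g p.2 / (p.1 + p.2))%:E).
Proof.
move=> c0.
have quot_le (x y : R) : c < x -> 0 < y -> `|(c + y) / (x + y)| <= 1.
  move=> cx y0; have x0 := lt_trans c0 cx.
  rewrite ger0_norm; last by rewrite divr_ge0// addr_ge0// ltW.
  by rewrite ler_pdivrMr ?addr_gt0// mul1r lerD2r ltW.
have mI : measurable (`]c, s]%classic : set (measurableTypeR R)).
  exact: measurable_itv.
have := integrable_prod mI measurable_halfline (f_int s c0) (g_int c0).
have mD : measurable (strip c s) by apply: measurableX.
move=> H.
have {}H : lebesgue2.-integrable (strip c s) (fun p =>
    (f p.1 * (g p.2 / (c + p.2)) * ((c + p.2) / (p.1 + p.2)))%:E).
  apply: (@integrableMl _ _ _ lebesgue2 _ mD _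
    (fun p : measurableTypeR R * measurableTypeR R => (c + p.2) / (p.1 + p.2)) H).
    have m1 : measurable_fun (strip c s) (fun p => p.1).
      by exact: measurable_funTS measurable_fst.
    have m2 : measurable_fun (strip c s) (fun p => p.2).
      by exact: measurable_funTS measurable_snd.
    apply: measurable_funM; first exact: measurable_funD.
    apply: measurable_funV_pos; last exact: measurable_funD.
    move=> [x y] [] /=; rewrite in_itv/= halflineE => /andP[cx _] y0.
    by rewrite addr_gt0// (lt_trans c0).
  exists 1; split; first exact: num_real.
  move=> M xM [x y] [] /=; rewrite in_itv/= halflineE => /andP[cx _] y0.
  by apply: le_trans (ltW xM); exact: quot_le.
apply: eq_integrable H => // -[x y] /set_mem [] /=.
rewrite in_itv/= halflineE => /andP[cx _] y0.
have : c + y != 0 by rewrite gt_eqF// addr_gt0.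
have : x + y != 0 by rewrite gt_eqF// addr_gt0// (lt_trans c0).
by move=> ? ?; congr EFin; field; apply/andP.
Qed.

(** Fubini reduces the strip to the integral of f G over ]c, s]; as f G is continuous, the
    fundamental theorem of calculus applies. *)
Lemma strip_derive (c s : R) : 0 < c -> c < s ->
  is_derive s 1 (fun s => \int[lebesgue2]_(p in strip c s)
      (f p.1 * g p.2 / (p.1 + p.2)))
    (f s * G s).
Proof.
move=> c0 cs.
have E s' : \int[lebesgue2]_(p in strip c s') (f p.1 * g p.2 / (p.1 + p.2)) =
   \int[mu]_(x in `]c, s']) (f x * G x).
  rewrite Rintegral_prod//; last 2 first.
  - exact: strip_integrable.
  - move=> x /=; rewrite in_itv/= => /andP[cx _].
    have := integrableZl measurable_halfline (f x) (g_int (lt_trans c0 cx)).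
    by apply: eq_integrable => // y _ /=; rewrite -EFinM mulrA.
  apply: eq_Rintegral => x /set_mem /=; rewrite in_itv/= => /andP[cx _].
  rewrite -RintegralZl//; last exact: (g_int (lt_trans c0 cx)).
  by apply: eq_Rintegral => y _; rewrite mulrA.
under eq_fun do rewrite E.
have fG_cont x : 0 < x -> {for x, continuous (fun x => f x * G x)}.
  by move=> x0; apply: cvgM; [exact: f_cont|exact: stieltjes_continuous].
(* The interval extends to s + 1 so that s is an interior point for the fundamental theorem of
   calculus. *)
have fG_int : mu.-integrable `]c, (s + 1)] (EFin \o (fun x => f x * G x)).
  apply: (@integrableS _ _ _ mu `[c, (s + 1)]) => //; first exact: subset_itv_oc_cc.
  apply: continuous_compact_integrable; first exact: segment_compact.
  apply: continuous_in_subspaceT => x /set_mem; rewrite /= in_itv/= => /andP[cx _].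
  by apply: fG_cont; exact: lt_le_trans cx.
have ss1 : s < s + 1 by rewrite ltrDl.
have cs' : (BRight c < BRight s)%O by rewrite bnd_simp.
have [d1 d2] := continuous_FTC1 ss1 fG_int cs' (fG_cont _ (lt_trans c0 cs)).
by split; [exact: d1|rewrite -derive1E; exact: d2].
Qed.

End RealKernel.
End StieltjesKernel.

(** * Linearity of componentwise complex integrals *)

Section ComplexIntegral.
Context d (T : measurableType d) (R : realType).
Variables (mu : {measure set T -> \bar R}) (D : set T).
Hypothesis mD : measurable D.
Implicit Types (f g : T -> R[i]) (z : R[i]).

Lemma eq_cintegral f g : {in D, f =1 g} ->
  cintegral mu D f = cintegral mu D g.
Proof. by move=> fg; congr Complex; apply: eq_Rintegral => x xD; rewrite fg. Qed.

Lemma eq_cintegrable f g : {in D, f =1 g} ->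
  cintegrable mu D f -> cintegrable mu D g.
Proof.
by move=> fg [f1 f2]; split; [move: f1|move: f2];
  apply: eq_integrable => // x xD /=; rewrite fg.
Qed.

Lemma cintegrable0 : cintegrable mu D (fun=> 0).
Proof. by split; exact: integrable0. Qed.

Lemma cintegral0 : cintegral mu D (fun=> 0) = 0.
Proof. by rewrite /cintegral /= !Rintegral_cst// !mul0r. Qed.

Lemma cintegrableZ z f : cintegrable mu D f ->
  cintegrable mu D (fun x => z * f x).
Proof.
move=> [f1 f2]; split.
  have := integrableB mD (integrableZl mD (complex.Re z) f1)
                         (integrableZl mD (complex.Im z) f2).
  by apply: eq_integrable => // x _ /=; rewrite Re_mulc.
have := integrableD mD (integrableZl mD (complex.Re z) f2)
                       (integrableZl mD (complex.Im z) f1).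
by apply: eq_integrable => // x _ /=; rewrite Im_mulc.
Qed.

Lemma cintegralZ z f : cintegrable mu D f ->
  cintegral mu D (fun x => z * f x) = z * cintegral mu D f.
Proof.
have int_scale (r : R) (h : T -> R) : mu.-integrable D (EFin \o h) ->
    mu.-integrable D (EFin \o (fun x => r * h x)) by exact: integrableZl.
move=> [f1 f2]; apply/eqP; rewrite eq_complex Re_mulc Im_mulc /=.
apply/andP; split; apply/eqP.
  under eq_Rintegral do rewrite Re_mulc.
  by rewrite RintegralB ?RintegralZl//; exact: int_scale.
under eq_Rintegral do rewrite Im_mulc.
by rewrite RintegralD ?RintegralZl//; exact: int_scale.
Qed.

Lemma cintegrableD f g : cintegrable mu D f -> cintegrable mu D g ->
  cintegrable mu D (fun x => f x + g x).
Proof.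
move=> [f1 f2] [g1 g2]; split.
  by have := integrableD mD f1 g1; apply: eq_integrable => // x _ /=; rewrite Re_addc.
by have := integrableD mD f2 g2; apply: eq_integrable => // x _ /=; rewrite Im_addc.
Qed.

Lemma cintegralD f g : cintegrable mu D f -> cintegrable mu D g ->
  cintegral mu D (fun x => f x + g x) = cintegral mu D f + cintegral mu D g.
Proof.
move=> [f1 f2] [g1 g2]; apply/eqP; rewrite eq_complex Re_addc Im_addc /=.
apply/andP; split; apply/eqP.
  by under eq_Rintegral do rewrite Re_addc; rewrite RintegralD.
by under eq_Rintegral do rewrite Im_addc; rewrite RintegralD.
Qed.

Lemma cintegral_lincomb (n : nat) (c : nat -> R[i]) (F : nat -> T -> R[i]) :
  (forall i, cintegrable mu D (F i)) ->
  cintegrable mu D (fun x => \sum_(i < n) c i * F i x) /\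
  cintegral mu D (fun x => \sum_(i < n) c i * F i x)
    = \sum_(i < n) c i * cintegral mu D (F i).
Proof.
move=> Fi; elim: n => [|n [IH1 IH2]].
  rewrite big_ord0; under [X in cintegral _ _ X]eq_fun do rewrite big_ord0.
  by under eq_fun do rewrite big_ord0; split; [exact: cintegrable0|exact: cintegral0].
rewrite big_ord_recr; under [X in cintegral _ _ X]eq_fun do rewrite big_ord_recr.
under eq_fun do rewrite big_ord_recr.
have Zi := cintegrableZ (c n) (Fi n).
by split; [exact: cintegrableD|rewrite cintegralD// IH2 cintegralZ].
Qed.

End ComplexIntegral.

(** * Complex kernels with a cut, and their derivative in the cut *)

Section ComplexStieltjes.
Context {R : realType}.
Local Notation mu := (@lebesgue_measure R).
Local Notation lebesgue2 := (mu \x mu)%E.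

Let measurable_halfline : measurable (@halfline R).
Proof. exact: measurable_itv. Qed.

Let measurable_quadrant : measurable (@quadrant R).
Proof. exact: measurableX. Qed.

(** The interval ]0, s[ has measure s > 0, so it cannot lie in a negligible set. *)
Lemma ae_itv_ex (s : R) (P : R -> Prop) : 0 < s ->
  {ae mu, forall x, P x} -> exists x : R, [/\ 0 < x, x < s & P x].
Proof.
move=> s0 aeP; apply: contrapT => /forallNP H.
have sub : (`]0, s[%classic : set (measurableTypeR R)) `<=` ~` P.
  by move=> x /=; rewrite in_itv/= => /andP[x0 xs] Px; exact: (H x).
have N : mu (`]0, s[%classic : set (measurableTypeR R)) = 0%E.
  exact: (proj1 (@negligibleP _ _ _ mu _ (measurable_itv `]0, s[))
    (negligibleS sub aeP)).
move: N; rewrite lebesgue_measure_itv /= lte_fin s0 oppr0 adde0 => -[sE].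
by rewrite sE ltxx in s0.
Qed.

Variables (u v : R -> R[i]) (xi : R[i]).

(** For a bimoment, [u] is the smooth factor in x and [v] the whole factor in y, its own cut
    included; [s] enters only through the jump. *)
Definition cut_kernel (s : R) (p : R * R) : R[i] :=
  (1 - xi * (s < p.1)%R%:R) * u p.1 * v p.2 / (p.1 + p.2)%:C.

Lemma Re_divC (z : R[i]) (r : R) : complex.Re (z / r%:C) = complex.Re z / r.
Proof. by rewrite -fmorphV Re_mulc/= mulr0 subr0. Qed.

Lemma Im_divC (z : R[i]) (r : R) : complex.Im (z / r%:C) = complex.Im z / r.
Proof. by rewrite -fmorphV Im_mulc/= mulr0 add0r. Qed.

(** Fubini gives an integrable section at almost every x0. Choose x0 < s, where the cut factor is 1
    (beyond s it is 1 - xi, which may vanish), divide by u(x0), and reach any x by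
    [stieltjes_integrable]. *)
Lemma cut_kernel_section (s : R) : 0 < s ->
  (forall x : R, 0 < x -> u x != 0) ->
  cintegrable lebesgue2 quadrant (cut_kernel s) ->
  forall x : R, 0 < x -> cintegrable mu halfline (fun y => v y / (x + y)%:C).
Proof.
move=> s0 u0 [k1 k2].
have [x0 [x00 x0s sec]] : exists x0 : R, [/\ 0 < x0, x0 < s &
    cintegrable mu halfline (fun y => cut_kernel s (x0, y))].
  have a1 := ae_integrable_xsection measurable_halfline measurable_halfline k1.
  have a2 := ae_integrable_xsection measurable_halfline measurable_halfline k2.
  have [x0 [x00 x0s [p1 p2]]] := ae_itv_ex s0 (filterI a1 a2).
  exists x0; split => //; have hx0 : halfline x0 by rewrite halflineE.
  by split; [exact: p1|exact: p2].
have vx0 : cintegrable mu halfline (fun y => v y / (x0 + y)%:C).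
  apply: (eq_cintegrable measurable_halfline _
    (cintegrableZ measurable_halfline (u x0)^-1 sec)) => y _.
  rewrite /cut_kernel /= ltNge (ltW x0s) /= mulr0 subr0 mul1r -mulrA mulKf//.
  exact: u0.
move=> x x_gt0; case: vx0 => v1 v2; split.
  have v1' : mu.-integrable halfline (fun y => (complex.Re (v y) / (x0 + y))%:E).
    by apply: eq_integrable v1 => // y _ /=; rewrite Re_divC.
  have := stieltjes_integrable x00 x_gt0 v1'.
  by apply: eq_integrable => // y _ /=; rewrite Re_divC.
have v2' : mu.-integrable halfline (fun y => (complex.Im (v y) / (x0 + y))%:E).
  by apply: eq_integrable v2 => // y _ /=; rewrite Im_divC.
have := stieltjes_integrable x00 x_gt0 v2'.
by apply: eq_integrable => // y _ /=; rewrite Im_divC.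
Qed.

Hypothesis uRe : forall x : R, 0 < x -> {for x, continuous (@complex.Re R \o u)}.
Hypothesis uIm : forall x : R, 0 < x -> {for x, continuous (@complex.Im R \o u)}.
Hypothesis u_neq0 : forall x : R, 0 < x -> u x != 0.

Let w x := xi * u x.

Let wRe (x : R) : 0 < x -> {for x, continuous (@complex.Re R \o w)}.
Proof.
move=> x0; rewrite (_ : _ \o _ = fun x => complex.Re xi * (@complex.Re R \o u) x
    - complex.Im xi * (@complex.Im R \o u) x).
  by apply: cvgB; apply: cvgM; [exact: cvg_cst|exact: uRe|exact: cvg_cst|exact: uIm].
by apply/funext => y /=; rewrite Re_mulc.
Qed.

Let wIm (x : R) : 0 < x -> {for x, continuous (@complex.Im R \o w)}.
Proof.
move=> x0; rewrite (_ : _ \o _ = fun x => complex.Re xi * (@complex.Im R \o u) x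
    + complex.Im xi * (@complex.Re R \o u) x).
  by apply: cvgD; apply: cvgM; [exact: cvg_cst|exact: uIm|exact: cvg_cst|exact: uRe].
by apply/funext => y /=; rewrite Im_mulc.
Qed.


Let strip (c s : R) : set (measurableTypeR R * measurableTypeR R) :=
  `]c, s] `*` halfline.

Let F s := cintegral lebesgue2 quadrant (cut_kernel s).

Let cut_kernelB (c s : R) p : c < s -> cut_kernel s p - cut_kernel c p
  = ((c < p.1 <= s)%R%:R * (w p.1 * v p.2)) / (p.1 + p.2)%:C.
Proof.
move=> cs; rewrite /cut_kernel -mulrBl; congr (_ / _).
rewrite -mulrBl /w mulrA; congr (_ * _).
have [cp|pc] := ltP c p.1; have [sp|ps] := ltP s p.1 => /=;
  rewrite ?mulr0 ?mulr1; try ring.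
by have := lt_trans cs sp; rewrite ltNge pc.
Qed.

Let g_int (part : R[i] -> R) : (part = @complex.Re R \/ part = @complex.Im R) ->
  (forall x : R, 0 < x -> cintegrable mu halfline (fun y => v y / (x + y)%:C)) ->
  forall x : R, 0 < x ->
    mu.-integrable halfline (fun y => (part (v y) / (x + y))%:E).
Proof.
move=> [] -> vi x /vi[v1 v2].
  by apply: eq_integrable v1 => // y _ /=; rewrite Re_divC.
by apply: eq_integrable v2 => // y _ /=; rewrite Im_divC.
Qed.

Let strip_quadrant (c s : R) : 0 < c -> quadrant `&` strip c s = strip c s.
Proof.
move=> c0; apply: setIidr => -[x y] [] /=; rewrite in_itv/= => /andP[cx _] y0.
by split => //=; rewrite halflineE (lt_trans c0).
Qed.

(** For a fixed cut c < s0, F(s) - F(c) is an integral over the strip between the cuts. It splits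
    into four real strip integrals, each differentiated by [strip_derive]. *)
Lemma cut_kernel_derive (s0 : R) : 0 < s0 ->
  (\forall s \near s0, cintegrable lebesgue2 quadrant (cut_kernel s)) ->
  is_cderive F s0 (xi * u s0 * cintegral mu halfline (fun y => v y / (s0 + y)%:C)).
Proof.
move=> s00 near_int.
have vi := cut_kernel_section s00 u_neq0 (nbhs_singleton near_int).
(* The cut c is close enough to s0 for its kernel to be integrable, and positive so that the strip
   stays away from x = 0. *)
have [c [c0 cs0 [c1 c2]]] : exists c : R, [/\ 0 < c, c < s0 &
    cintegrable lebesgue2 quadrant (cut_kernel c)].
  near s0^'- => c; exists c; split; first by near: c; exact: nbhs_left_gt.
    by near: c; exact: nbhs_left_lt.
  by near: c; rewrite near_withinE; apply: filterS near_int.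
have iR := g_int (or_introl erefl) vi; have iI := g_int (or_intror erefl) vi.
pose re := @complex.Re R; pose im := @complex.Im R.
(* [f] and [g] range over real and imaginary part, which yields the four real products inside the
   complex product w v. *)
pose Phi (f g : R[i] -> R) s :=
  \int[lebesgue2]_(p in strip c s) ((f \o w) p.1 * (g \o v) p.2 / (p.1 + p.2)).
have stripS (h : R * R -> R) s : c < s ->
    \int[lebesgue2]_(p in quadrant) ((c < p.1 <= s)%R%:R * h p)
    = \int[lebesgue2]_(p in strip c s) h p.
  move=> cs; rewrite -(strip_quadrant s c0) [RHS]Rintegral_mkcondr.
  apply: eq_Rintegral => -[x y] /set_mem [_ y0]; rewrite patchE in_setX.
  rewrite [y \in _]mem_set// andbT /= mem_setE/= in_itv/=.
  by case: ifP; rewrite ?mul1r ?mul0r.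
have Fs : \forall s \near s0, F c + ((Phi re re s - Phi im im s)
    +i* (Phi re im s + Phi im re s)) = F s.
  near=> s.
  have cs : c < s by near: s; apply: (cvgr_gt s0) => //; exact: cvg_id.
  have [s1 s2] : cintegrable lebesgue2 quadrant (cut_kernel s) by near: s.
  have mS : measurable (strip c s) by apply: measurableX => //; exact: measurable_itv.
  have sI (f g : R[i] -> R) := fun hf hg =>
    @strip_integrable _ (f \o w) (g \o v) hf hg c s c0.
  have RR := sI _ _ wRe iR; have II := sI _ _ wIm iI.
  have RI := sI _ _ wRe iI; have IR := sI _ _ wIm iR.
  have ER : complex.Re (F s) - complex.Re (F c)
      = Phi re re s - Phi im im s.
    transitivity (\int[lebesgue2]_(p in quadrant)
        (complex.Re (cut_kernel s p) - complex.Re (cut_kernel c p))).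
      by rewrite RintegralB.
    transitivity (\int[lebesgue2]_(p in strip c s)
        (complex.Re (w p.1) * complex.Re (v p.2) / (p.1 + p.2)
         - complex.Im (w p.1) * complex.Im (v p.2) / (p.1 + p.2))); last first.
      by rewrite RintegralB.
    rewrite -stripS//.
    apply: eq_Rintegral => p _.
    rewrite -Re_subc cut_kernelB// Re_divC /=.
    by case: (c < p.1 <= s)%R; rewrite ?mul1r ?mul0r// Re_mulc mulrBl.
  have EI : complex.Im (F s) - complex.Im (F c)
      = Phi re im s + Phi im re s.
    transitivity (\int[lebesgue2]_(p in quadrant)
        (complex.Im (cut_kernel s p) - complex.Im (cut_kernel c p))).
      by rewrite RintegralB.
    transitivity (\int[lebesgue2]_(p in strip c s)
        (complex.Re (w p.1) * complex.Im (v p.2) / (p.1 + p.2)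
         + complex.Im (w p.1) * complex.Re (v p.2) / (p.1 + p.2))); last first.
      by rewrite RintegralD.
    rewrite -stripS//.
    apply: eq_Rintegral => p _.
    rewrite -Im_subc cut_kernelB// Im_divC /=.
    by case: (c < p.1 <= s)%R; rewrite ?mul1r ?mul0r// Im_mulc mulrDl.
  rewrite -ER -EI -(Re_subc (F s)) -(Im_subc (F s)).
  by case: (F s) (F c) => ? ? [? ?] /=; congr Complex; ring.
apply: (near_eq_is_cderive Fs).
have dPhi (f g : R[i] -> R) := fun hf hg =>
  @strip_derive _ (f \o w) (g \o v) hf hg c s0 c0 cs0.
have RR := dPhi _ _ wRe iR; have II := dPhi _ _ wIm iI.
have RI := dPhi _ _ wRe iI; have IR := dPhi _ _ wIm iR.
have GE : cintegral mu halfline (fun y => v y / (s0 + y)%:C) =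
  (\int[mu]_(y in halfline) (complex.Re (v y) / (s0 + y))) +i*
  (\int[mu]_(y in halfline) (complex.Im (v y) / (s0 + y))).
  by congr Complex; apply: eq_Rintegral => y _; rewrite ?Re_divC ?Im_divC.
split; rewrite GE.
  have : is_derive s0 1 (fun s => complex.Re (F c)
      + (Phi re re s - Phi im im s)) _
    := is_deriveD (is_derive_cst _ _ _) (is_deriveB RR II).
  by rewrite add0r => D1; apply: (is_derive_eq D1); rewrite Re_mulc.
have : is_derive s0 1 (fun s => complex.Im (F c)
    + (Phi re im s + Phi im re s)) _
  := is_deriveD (is_derive_cst _ _ _) (is_deriveD RI IR).
by rewrite add0r => D1; apply: (is_derive_eq D1); rewrite Im_mulc.
Unshelve. all: by end_near. Qed.

End ComplexStieltjes.

(** * Derivatives of the bimoments *)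

Section BimomentDerivatives.
Context {R : realType}.
Local Notation mu := (@lebesgue_measure R).
Local Notation lebesgue2 := (mu \x mu)%E.
Implicit Types (a b xi psi : R[i]) (s t x : R) (f g : {poly R[i]}) (j k : nat).

Let measurable_halfline : measurable (@halfline R).
Proof. exact: measurable_itv. Qed.

Let measurable_quadrant : measurable (@quadrant R).
Proof. exact: measurableX. Qed.

(** The weight without its cut factor, with the power x^j absorbed. *)
Definition smooth_weight a j x : R[i] :=
  cpow x a * (expR (- x))%:C * x%:C ^+ j.

(** The phase of x^a cannot vanish since cos^2 + sin^2 = 1, and the remaining factors are
    positive. *)
Lemma smooth_weight_neq0 a j x : 0 < x -> smooth_weight a j x != 0.
Proof.
move=> x0; rewrite /smooth_weight /cpow !mulf_neq0 ?expf_neq0//.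
- by rewrite eq_complex /= gt_eqF ?expR_gt0.
- rewrite eq_complex /=; apply/negP => /andP[/eqP c0 /eqP s0].
  have := cos2Dsin2 (complex.Im a * ln x).
  by rewrite c0 s0 expr0n /= addr0 => /esym/eqP; rewrite oner_eq0.
- by rewrite eq_complex /= gt_eqF ?expR_gt0.
- by rewrite eq_complex /= gt_eqF.
Qed.

(** [trig] stands for cos in the real part of the weight and for sin in the imaginary part. *)
Let exp_part_continuous a j x (trig : R -> R) : continuous trig -> 0 < x ->
  {for x, continuous (fun x => expR (complex.Re a * ln x)
     * trig (complex.Im a * ln x) * expR (- x) * x ^+ j)}.
Proof.
move=> trig_cont x0.
have lnc (c : R) : c * ln y @[y --> x] --> c * ln x.
  by apply: cvgM; [exact: cvg_cst|exact: continuous_ln].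
apply: cvgM; last exact: exprn_continuous.
apply: cvgM; last first.
  by apply: continuous_comp; [exact: opp_continuous|exact: continuous_expR].
apply: cvgM.
  by apply: (cvg_comp _ _ (lnc _)); exact: continuous_expR.
by apply: (cvg_comp _ _ (lnc _)); exact: trig_cont.
Qed.

Lemma smooth_weight_Re_continuous a j x : 0 < x ->
  {for x, continuous (@complex.Re R \o smooth_weight a j)}.
Proof.
move=> x0; rewrite (_ : _ \o _ = fun x => expR (complex.Re a * ln x)
     * cos (complex.Im a * ln x) * expR (- x) * x ^+ j).
  exact: exp_part_continuous (@continuous_cos R) x0.
apply/funext => y; rewrite /= /smooth_weight /cpow -rmorphXn.
by rewrite !Re_mulc !Im_mulc /= !mul0r !mulr0 !subr0.
Qed.

Lemma smooth_weight_Im_continuous a j x : 0 < x ->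
  {for x, continuous (@complex.Im R \o smooth_weight a j)}.
Proof.
move=> x0; rewrite (_ : _ \o _ = fun x => expR (complex.Re a * ln x)
     * sin (complex.Im a * ln x) * expR (- x) * x ^+ j).
  exact: exp_part_continuous (@continuous_sin R) x0.
apply/funext => y; rewrite /= /smooth_weight /cpow -rmorphXn.
by rewrite !Im_mulc !Re_mulc /= !mul0r !mulr0 !addr0 !add0r.
Qed.

Lemma pair_integrandXn a b xi psi s t j k :
  pair_integrand a b xi psi s t 'X^j 'X^k
  = cut_kernel (smooth_weight a j) (fun y => weight psi b t y * y%:C ^+ k) xi s.
Proof.
apply/funext => p; rewrite /pair_integrand /cut_kernel /smooth_weight !hornerXn.
by rewrite /weight; ring.
Qed.

(** The factor depending on k in the s-derivative of M_{j,k}; the matrix of these derivatives has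
    rank at most one. *)
Definition stieltjes_moment b psi s t k : R[i] :=
  cintegral mu halfline (fun y => weight psi b t y * y%:C ^+ k / (s + y)%:C).

Lemma bimoment_derive a b xi psi s t j k : 0 < s ->
  (\forall s' \near s, bimoment_convergent a b xi psi s' t j k) ->
  is_cderive (fun s' => bimoment a b xi psi s' t j k) s
    (xi * smooth_weight a j s * stieltjes_moment b psi s t k).
Proof.
move=> s0 conv.
apply: (@near_eq_is_cderive _ (fun s' => cintegral lebesgue2 quadrant
    (cut_kernel (smooth_weight a j) (fun y => weight psi b t y * y%:C ^+ k) xi s'))).
  by apply: filterS conv => s' _; rewrite /bimoment /pairing pair_integrandXn.
apply: cut_kernel_derive; last 2 first.
- exact: s0.
- by apply: filterS conv => s'; rewrite /bimoment_convergent pair_integrandXn.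
- by move=> x; exact: smooth_weight_Re_continuous.
- by move=> x; exact: smooth_weight_Im_continuous.
- by move=> x; exact: smooth_weight_neq0.
Qed.

(** The integrand is invariant under exchange of (a, xi, s, x, j) with (b, psi, t, y, k), so
    t-derivatives can be read off s-derivatives. *)
Lemma bimomentC a b xi psi s t j k : bimoment_convergent a b xi psi s t j k ->
  bimoment_convergent b a psi xi t s k j /\
  bimoment b a psi xi t s k j = bimoment a b xi psi s t j k.
Proof.
have E p : pair_integrand b a psi xi t s 'X^k 'X^j p
    = pair_integrand a b xi psi s t 'X^j 'X^k (p.2, p.1).
  by rewrite /pair_integrand /= (addrC p.2); ring.
rewrite /bimoment_convergent /bimoment /pairing (_ : pair_integrand b _ _ _ _ _ _ _
  = fun p => pair_integrand a b xi psi s t 'X^j 'X^k (p.2, p.1)); last exact/funext.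
move=> [i1 i2].
have [j1 e1] := integrable_swap measurable_halfline measurable_halfline i1.
have [j2 e2] := integrable_swap measurable_halfline measurable_halfline i2.
by split=> //; congr Complex.
Qed.

(** Bridge from integrals to the algebra of moments: convergence of all bimoments lets the finite
    sums leave the integral. *)
Lemma pairing_bform a b xi psi s t f g :
  (forall j k, bimoment_convergent a b xi psi s t j k) ->
  pairing a b xi psi s t f g = bform (bimoment a b xi psi s t) f g.
Proof.
move=> conv.
(* The powers of y are summed first, so that linearity is applied in one variable at a time. *)
pose row j p := \sum_(k < size g) g`_k * pair_integrand a b xi psi s t 'X^j 'X^k p.
have row_int j : cintegrable lebesgue2 quadrant (row j) /\
    cintegral lebesgue2 quadrant (row j) = lform (bimoment a b xi psi s t j) g.
  exact: (cintegral_lincomb measurable_quadrant (size g) (fun k => g`_k) (conv j)).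
transitivity (cintegral lebesgue2 quadrant
    (fun p => \sum_(j < size f) f`_j * row j p)).
  apply: eq_cintegral => p _; rewrite /pair_integrand !horner_coef.
  rewrite -mulrA mulr_suml mulr_sumr; apply: eq_bigr => j _.
  rewrite /row !mulr_sumr; apply: eq_bigr => k _.
  by rewrite /pair_integrand !hornerXn; ring.
rewrite (cintegral_lincomb measurable_quadrant (size f) (fun j => f`_j)
  (fun j => (row_int j).1)).2.
by apply: eq_bigr => j _; rewrite (row_int j).2.
Qed.

(** At z = -s the denominator z - y equals -(s + y), whence the minus sign. *)
Lemma cauchy_transform_lform a b xi psi s t g : 0 < s ->
  (forall j k, bimoment_convergent a b xi psi s t j k) ->
  cauchy_transform (weight psi b t) g (- s%:C)
    = - lform (stieltjes_moment b psi s t) g.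
Proof.
move=> s0 conv.
have int_k k : cintegrable mu halfline
    (fun y => weight psi b t y * y%:C ^+ k / (s + y)%:C).
  (* Convergence of the bimoment with j = 0 and this k suffices; it is transferred to the section at
     x = s. *)
  apply: (cut_kernel_section s0 (@smooth_weight_neq0 a 0) _ s0).
  rewrite -pair_integrandXn; exact: conv.
rewrite /lform -sumrN.
transitivity (cintegral mu halfline (fun y => \sum_(k < size g)
    (- g`_k) * (weight psi b t y * y%:C ^+ k / (s + y)%:C))).
  apply: eq_cintegral => y _; rewrite horner_coef mulr_sumr.
  apply: eq_bigr => k _; rewrite -opprD -rmorphD/= invrN; ring.
rewrite (cintegral_lincomb measurable_halfline (size g) (fun k => - g`_k) int_k).2.
by apply: eq_bigr => k _; rewrite mulNr.
Qed.

(** The matrix is a factor in j times a factor in k, so the form factors: the powers of s assemble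
    to f(s), the Stieltjes moments to minus the Cauchy transform at -s. *)
Lemma bform_derive_moments a b xi psi s t f g : 0 < s ->
  (forall j k, bimoment_convergent a b xi psi s t j k) ->
  bform (fun j k => xi * smooth_weight a j s * stieltjes_moment b psi s t k) f g
  = - (xi * cpow s a * (expR (- s))%:C * f.[s%:C]
       * cauchy_transform (weight psi b t) g (- s%:C)).
Proof.
move=> s0 conv; rewrite (cauchy_transform_lform g s0 conv) mulrN opprK.
rewrite /bform; under [X in lform X]eq_fun do rewrite lformZm.
set L := lform (stieltjes_moment _ _ _ _) g.
rewrite horner_coef; move: L => L.
rewrite mulr_sumr mulr_suml; apply: eq_bigr => j _.
rewrite /smooth_weight; ring.
Qed.

End BimomentDerivatives.

(** * Assembly of the four derivative formulas *)

Lemma increment_factor {F : comPzRingType} (r r' w p q p' q' : F) :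
  r * - (w * p * q) - r' * - (w * p' * q') = w * (- r * p * q + r' * p' * q').
Proof. by ring. Qed.

Lemma increment_factor0 {F : comPzRingType} (r w p q : F) :
  r * - (w * p * q) - 0 = w * (- r * p * q + 0).
Proof. by ring. Qed.

Lemma is_cderive_eq {R : realType} (f : R -> R[i]) (x : R) (k l : R[i]) :
  is_cderive f x k -> k = l -> is_cderive f x l.
Proof. by move=> fk <-. Qed.

Section Slices.
Context {R : realType}.
Variables (U : set (R * R)) (s t : R).
Hypotheses (Uopen : open U) (Ust : U (s, t)).

Lemma open_near_fst : \forall s' \near s, U (s', t).
Proof.
have : (fun s' : R => (s', t)) @ s --> (s, t).
  by apply: (@cvg_pair _ _ _ (nbhs s) (nbhs s) (nbhs t) _ _ _ id (fun=> t)) => //;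
    exact: cvg_cst.
by move=> /(_ U); apply; apply: open_nbhs_nbhs.
Qed.

Lemma open_near_snd : \forall t' \near t, U (s, t').
Proof.
have : (fun t' : R => (s, t')) @ t --> (s, t).
  by apply: (@cvg_pair _ _ _ (nbhs t) (nbhs s) (nbhs t) _ _ _ (fun=> s) id) => //;
    exact: cvg_cst.
by move=> /(_ U); apply; apply: open_nbhs_nbhs.
Qed.

End Slices.

Theorem proposition4p15 (R : realType) (a b xi psi : R[i])
  (ha : -1 < complex.Re a) (hb : -1 < complex.Re b)
  (U : set (R * R)) (Uopen : open U)
  (Upos : forall s t : R, U (s, t) -> 0 < s /\ 0 < t)
  (Mconv : forall s t : R, U (s, t) -> forall j k : nat,
     bimoment_convergent a b xi psi s t j k)
  (Zneq0 : forall s t : R, U (s, t) -> forall n : nat,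
     Zdet a b xi psi s t n != 0)
  (S_ : nat -> R -> R -> R[i])
  (Ssqr : forall s t : R, U (s, t) -> forall n : nat,
     S_ n s t ^+ 2 = Zdet a b xi psi s t n / Zdet a b xi psi s t n.+1)
  (Sdiff : forall s t : R, U (s, t) -> forall n : nat,
     cdifferentiable2 (S_ n) (s, t))
  (P Q : nat -> R -> R -> {poly R[i]})
  (Psize : forall s t : R, U (s, t) -> forall n : nat,
     size (P n s t) = n.+1 /\ lead_coef (P n s t) = S_ n s t)
  (Qsize : forall s t : R, U (s, t) -> forall n : nat,
     size (Q n s t) = n.+1 /\ lead_coef (Q n s t) = S_ n s t)
  (PQ : forall s t : R, U (s, t) -> forall m n : nat,
     pairing a b xi psi s t (P m s t) (Q n s t) = (m == n)%:R)
  (w1P : forall s t : R, U (s, t) -> forall n : nat,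
     weight_integral (weight xi a s) (P n s t) != 0)
  (w2Q : forall s t : R, U (s, t) -> forall n : nat,
     weight_integral (weight psi b t) (Q n s t) != 0) :
  let X n s t := pairing a b xi psi s t ('X * P n s t) (Q n s t) in
  let Y n s t := pairing a b xi psi s t (P n s t) ('X * Q n s t) in
  let P1 n s t z := cauchy_transform (weight xi a s) (P n s t) z in
  let Q1 n s t z := cauchy_transform (weight psi b t) (Q n s t) z in
  forall (n : nat) (s t : R), U (s, t) ->
  let Sn := S_ n s t in
  let Snext := S_ n.+1 s t in
  let Sprev := at_pred (fun m => S_ m s t) n in
  let ws := xi * cpow s a * (expR (- s))%:C in
  let wt := psi * cpow t b * (expR (- t))%:C in
  [/\ is_cderive (fun s' => X n s' t) s
        (ws * (- (Sn / Snext) * (P n.+1 s t).[s%:C] * Q1 n s t (- s%:C)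
               + Sprev / Sn * (P n s t).[s%:C]
                 * at_pred (fun m => Q1 m s t (- s%:C)) n)),
      is_cderive (fun t' => X n s t') t
        (wt * (- (Sn / Snext) * P1 n.+1 s t (- t%:C) * (Q n s t).[t%:C]
               + Sprev / Sn * P1 n s t (- t%:C)
                 * (at_pred (fun m => Q m s t) n).[t%:C])),
      is_cderive (fun s' => Y n s' t) s
        (ws * (- (Sn / Snext) * (P n s t).[s%:C] * Q1 n.+1 s t (- s%:C)
               + Sprev / Sn * (at_pred (fun m => P m s t) n).[s%:C]
                 * Q1 n s t (- s%:C)))
    & is_cderive (fun t' => Y n s t') t
        (wt * (- (Sn / Snext) * P1 n s t (- t%:C) * (Q n.+1 s t).[t%:C]
               + Sprev / Sn * at_pred (fun m => P1 m s t (- t%:C)) n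
                 * (Q n s t).[t%:C]))].
Proof.
move=> X Y P1 Q1 n s t Ust Sn Snext Sprev ws wt.
have [s0 t0] := Upos _ _ Ust.
have bo s' t' : U (s', t') -> biorthonormal (bimoment a b xi psi s' t')
    (fun m => S_ m s' t') (fun m => P m s' t') (fun m => Q m s' t').
  move=> Ust'; split=> //.
  - exact: Zneq0.
  - by move=> m; exact: Psize.
  - by move=> m; exact: Qsize.
  - by move=> i j; rewrite -pairing_bform ?PQ//; exact: Mconv.
have near_s := open_near_fst Uopen Ust.
have near_t := open_near_snd Uopen Ust.
have XE s' t' : U (s', t') ->
    bform (bimoment a b xi psi s' t') ('X * P n s' t') (Q n s' t') = X n s' t'.
  by move=> /Mconv conv; rewrite -pairing_bform.
(* Y is the X of the transposed moments, with [P] and [Q] exchanged. *)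
have YE s' t' : U (s', t') ->
    bform (fun j k => bimoment a b xi psi s' t' k j) ('X * Q n s' t') (P n s' t')
      = Y n s' t'.
  by move=> /Mconv conv; rewrite bformC -pairing_bform.
have conv_t j k : bimoment_convergent b a psi xi t s j k.
  by have [] := bimomentC (Mconv s t Ust k j).
have Ds j k : is_cderive (fun s' => bimoment a b xi psi s' t j k) s
    (xi * smooth_weight a j s * stieltjes_moment b psi s t k).
  by apply: bimoment_derive => //; apply: filterS near_s => s' /Mconv.
(* Obtained from the derivative in the first cut by exchanging the two variables. *)
have Dt j k : is_cderive (fun t' => bimoment a b xi psi s t' j k) t
    (psi * smooth_weight b k t * stieltjes_moment a xi t s j).
  apply: (@near_eq_is_cderive _ (fun t' => bimoment b a psi xi t' s k j)).
    by apply: filterS near_t => t' /Mconv/(_ j k)/bimomentC[].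
  apply: bimoment_derive => //.
  by apply: filterS near_t => t' /Mconv/(_ j k)/bimomentC[].
have Es f g :
    bform (fun j k => xi * smooth_weight a j s
      * stieltjes_moment b psi s t k) f g
    = - (ws * f.[s%:C] * cauchy_transform (weight psi b t) g (- s%:C)).
  by apply: bform_derive_moments => //; exact: Mconv.
have Et f g :
    bform (fun k j => psi * smooth_weight b k t
      * stieltjes_moment a xi t s j) f g
    = - (wt * cauchy_transform (weight xi a s) g (- t%:C) * f.[t%:C]).
  by rewrite mulrAC; exact: bform_derive_moments.
(* [Es] serves X in s and [Et] serves Y in t; the other two formulas use the opposite order of
   indices. *)
have EsC f g :
    bform (fun k j => xi * smooth_weight a j s
      * stieltjes_moment b psi s t k) f g
    = - (ws * g.[s%:C] * cauchy_transform (weight psi b t) f (- s%:C)).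
  by rewrite bformC Es.
have EtC f g :
    bform (fun j k => psi * smooth_weight b k t
      * stieltjes_moment a xi t s j) f g
    = - (wt * cauchy_transform (weight xi a s) f (- t%:C) * g.[t%:C]).
  by rewrite bformC Et.
have near_bo_s : \forall s' \near s, biorthonormal (bimoment a b xi psi s' t)
    (fun m => S_ m s' t) (fun m => P m s' t) (fun m => Q m s' t).
  by apply: filterS near_s => s'; exact: bo.
have near_bo_t : \forall t' \near t, biorthonormal (bimoment a b xi psi s t')
    (fun m => S_ m s t') (fun m => P m s t') (fun m => Q m s t').
  by apply: filterS near_t => t'; exact: bo.
split.
- apply: (@near_eq_is_cderive _ _ (fun s' => X n s' t)).
    by apply: filterS near_s => s'; exact: XE.
  apply: (is_cderive_eq (bform_mulX_derive (S := fun m s' => S_ m s' t)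
    (P := fun m s' => P m s' t) (Q := fun m s' => Q m s' t) near_bo_s Ds n)).
  rewrite !Es /Sprev /Sn /Snext.
  (* For n = 0 the terms of index -1 vanish and a single term is left, hence a separate identity. *)
  case: (n) => [|m] /=; last exact: increment_factor.
  by rewrite !mul0r; exact: increment_factor0.
- apply: (@near_eq_is_cderive _ _ (fun t' => X n s t')).
    by apply: filterS near_t => t'; exact: XE.
  apply: (is_cderive_eq (bform_mulX_derive (S := fun m t' => S_ m s t')
    (P := fun m t' => P m s t') (Q := fun m t' => Q m s t') near_bo_t Dt n)).
  rewrite !EtC /Sprev /Sn /Snext.
  case: (n) => [|m] /=; last exact: increment_factor.
  by rewrite !mul0r; exact: increment_factor0.
- apply: (@near_eq_is_cderive _ _ (fun s' => Y n s' t)).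
    by apply: filterS near_s => s'; exact: YE.
  (* After transposition by [biorthonormalC], [Q] takes the place of [P] in the general
     derivative. *)
  apply: (is_cderive_eq (bform_mulX_derive (S := fun m s' => S_ m s' t)
    (P := fun m s' => Q m s' t) (Q := fun m s' => P m s' t)
    (filterS (fun s' => @biorthonormalC _ _ _ _ _) near_bo_s)
    (fun j k => Ds k j) n)).
  rewrite !EsC /Sprev /Sn /Snext.
  case: (n) => [|m] /=; last exact: increment_factor.
  by rewrite !mul0r; exact: increment_factor0.
- apply: (@near_eq_is_cderive _ _ (fun t' => Y n s t')).
    by apply: filterS near_t => t'; exact: YE.
  apply: (is_cderive_eq (bform_mulX_derive (S := fun m t' => S_ m s t')
    (P := fun m t' => Q m s t') (Q := fun m t' => P m s t')
    (filterS (fun t' => @biorthonormalC _ _ _ _ _) near_bo_t)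
    (fun j k => Dt k j) n)).
  rewrite !Et /Sprev /Sn /Snext.
  case: (n) => [|m] /=; last exact: increment_factor.
  by rewrite !mul0r; exact: increment_factor0.
Qed.
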